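(* Let $H$ be a finite dimensional Hopf algebra over a field $\mathbf{k}$ with antipode $S$. Assume that $S^2\neq\mathrm{id}$ and that $$H=\bigoplus_{z\in\mathbf{k}^*}H_z,\qquad\text{where } H_z=\{h\in H: S^2(h)=zh\}.$$ Then this decomposition is not strongly graded.
   Context: Here $\mathbf{k}^*$ is the multiplicative group of nonzero elements of $\mathbf{k}$. A grading $A=\bigoplus_{g\in L}A_g$ of an algebra $A$ by a group $L$ is strongly graded if $A_gA_h=A_{gh}$ for all $g,h\in L$. *)

(* Defs.v *)
From HB Require Import structures.
From mathcomp Require Import all_boot all_algebra falgebra.

Set Implicit Arguments.
Unset Strict Implicit.
Unset Printing Implicit Defensive.

Import GRing.Theory.
Local Open Scope ring_scope.

(* Tensor product of finite-dimensional spaces. An element of V (x) W is the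
   matrix of its coordinates on the family (e_i (x) f_j), where e and f are the
   bases [vbasis fullv] of V and W. The lemmas [tens_lift_tens] and
   [tens_lift_uniq] give the universal property, so the choice of bases is
   immaterial. *)

Section Tensor.
Variable k : fieldType.
Implicit Types V W U : vectType k.

Definition tensor V W : vectType k := 'M[k]_(\dim {:V}, \dim {:W}).

Definition tens V W (v : V) (w : W) : tensor V W :=
  \matrix_(i, j) (coord (vbasis {:V}) i v * coord (vbasis {:W}) j w).

(* The linear map induced by B when B is bilinear (the value is meaningless
   otherwise). In Sweedler notation, tens_lift B (comul h) is the sum of the
   B h_(1) h_(2). *)
Definition tens_lift V W U (B : V -> W -> U)
    (t : 'M[k]_(\dim {:V}, \dim {:W})) : U :=
  \sum_i \sum_j t i j *: B (vbasis {:V})`_i (vbasis {:W})`_j.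

Definition is_bilinear V W U (B : V -> W -> U) :=
  (forall w, linear (B^~ w)) /\ (forall v, linear (B v)).

Lemma tens_bilinear V W : is_bilinear (@tens V W).
Proof.
by split=> [w|v] a x y; apply/matrixP=> i j; rewrite !mxE linearP /=;
  rewrite ?mulrDl ?mulrDr -?mulrA // mulrCA.
Qed.

Lemma tens_lift_linear V W U (B : V -> W -> U) :
  linear (tens_lift B : tensor V W -> U).
Proof.
move=> a s t; rewrite /tens_lift scaler_sumr -big_split /=.
apply: eq_bigr => i _; rewrite scaler_sumr -big_split /=.
by apply: eq_bigr => j _; rewrite !mxE scalerDl scalerA.
Qed.

HB.instance Definition _ V W U (B : V -> W -> U) :=
  GRing.isLinear.Build k (tensor V W) U *:%R (tens_lift B)
    (tens_lift_linear B).

Lemma tens_lift_tens V W U (B : V -> W -> U) v w :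
  is_bilinear B -> tens_lift B (tens v w) = B v w.
Proof.
case=> Bl Br; rewrite /tens_lift.
have linD (X Y : vectType k) (f : X -> Y) : linear f ->
    forall n (c : 'I_n -> k) (x : 'I_n -> X),
    f (\sum_i c i *: x i) = \sum_i c i *: f (x i).
  move=> fl n c x; pose fc := GRing.isLinear.Build k X Y *:%R f fl.
  pose g : {linear X -> Y} := HB.pack f fc.
  rewrite -[f]/(g : X -> Y) linear_sum.
  by apply: eq_bigr => i _; rewrite linearZ.
rewrite [in RHS](coord_vbasis (memvf v)) (linD _ _ (B^~ w) (Bl w)).
apply: eq_bigr => i _.
rewrite [in RHS](coord_vbasis (memvf w)) (linD _ _ _ (Br _)) scaler_sumr.
by apply: eq_bigr => j _; rewrite mxE scalerA.
Qed.

Lemma tens_lift_uniq V W U (B : V -> W -> U) (f : {linear tensor V W -> U}) :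
  (forall v w, f (tens v w) = B v w) -> forall t, f t = tens_lift B t.
Proof.
move=> fB t; rewrite /tens_lift [in LHS](matrix_sum_delta t) linear_sum /=.
apply: eq_bigr => i _; rewrite linear_sum /=.
apply: eq_bigr => j _; rewrite linearZ /= -fB; congr (_ *: f _).
apply/matrixP=> p q; rewrite !mxE !coord_free ?(basis_free (vbasisP _)) //.
by rewrite -!val_eqE -natrM mulnb; congr (_ && _)%:R; rewrite eq_sym.
Qed.

Definition tens_map V V' W W' (f : V -> V') (g : W -> W')
    (t : tensor V W) : tensor V' W' :=
  tens_lift (fun v w => tens (f v) (g w)) t.

Definition tens_assoc U V W (t : tensor (tensor U V) W) :
    tensor U (tensor V W) :=
  tens_lift (fun s w => tens_lift (fun u v => tens u (tens v w)) s) t.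

End Tensor.

Definition tens_mul (k : fieldType) (A B : falgType k) (s t : tensor A B) :
    tensor A B :=
  tens_lift (fun a b => tens_lift (fun a' b' => tens (a * a') (b * b')) t) s.

Record hopf_structure (k : fieldType) (H : falgType k) := HopfStructure {
  comul : {linear H -> tensor H H};
  counit : {lrmorphism H -> k | *%R};
  antipode : 'End(H);
  comulA : forall h, tens_assoc (tens_map comul idfun (comul h)) =
                     tens_map idfun comul (comul h);
  counitl : forall h, tens_lift (fun x y => counit x *: y) (comul h) = h;
  counitr : forall h, tens_lift (fun x y => counit y *: x) (comul h) = h;
  comul1 : comul 1 = tens 1 1;
  comulM : forall x y, comul (x * y) = tens_mul (comul x) (comul y);
  antipodel :
    forall h, tens_lift (fun x y => antipode x * y) (comul h) = (counit h)%:A;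
  antipoder :
    forall h, tens_lift (fun x y => x * antipode y) (comul h) = (counit h)%:A
}.

Section NonzeroGroup.
Variable k : fieldType.

Record nonzero := Nonzero { nonzero_val :> k; _ : nonzero_val != 0 }.

HB.instance Definition _ := [isSub for nonzero_val].
HB.instance Definition _ := [Choice of nonzero by <:].

Implicit Types x y z : nonzero.

Lemma nonzeroP x : nonzero_val x != 0. Proof. by case: x. Qed.

Definition nonzero_one := Nonzero (oner_neq0 k).
Definition nonzero_mul x y := Nonzero (mulf_neq0 (nonzeroP x) (nonzeroP y)).
Definition nonzero_inv x := Nonzero (invr_neq0 (nonzeroP x)).

Fact nonzeroMA : associative nonzero_mul.
Proof. by move=> x y z; apply: val_inj; rewrite /= mulrA. Qed.
Fact nonzero1M : left_id nonzero_one nonzero_mul.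
Proof. by move=> x; apply: val_inj; rewrite /= mul1r. Qed.
Fact nonzeroM1 : right_id nonzero_one nonzero_mul.
Proof. by move=> x; apply: val_inj; rewrite /= mulr1. Qed.
Fact nonzeroVM : left_inverse nonzero_one nonzero_inv nonzero_mul.
Proof. by move=> x; apply: val_inj; rewrite /= mulVf ?nonzeroP. Qed.
Fact nonzeroMV : right_inverse nonzero_one nonzero_inv nonzero_mul.
Proof. by move=> x; apply: val_inj; rewrite /= mulfV ?nonzeroP. Qed.

HB.instance Definition _ :=
  isGroup.Build nonzero nonzeroMA nonzero1M nonzeroM1 nonzeroVM nonzeroMV.

End NonzeroGroup.

(* V is the direct sum of the family D, whose index set may be infinite: every
   vector lies in the sum of finitely many D i, and every finite subfamily is
   in direct sum. *)
Definition direct_sum_decomposition (k : fieldType) (V : vectType k)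
    (I : eqType) (D : I -> {vspace V}) : Prop :=
  (forall v, exists s : seq I, v \in (\sum_(i <- s) D i)%VS) /\
  (forall s : seq I, uniq s -> directv (\sum_(i <- s) D i)).

(* The product of two subspaces is the span of the products of their elements;
   the index group is written multiplicatively. *)
Definition strongly_graded (k : fieldType) (A : falgType k) (L : groupType)
    (D : L -> {vspace A}) : Prop :=
  forall g h : L, (D g * D h)%VS = D (g * h)%g.

Definition antipode2_eigenspace (k : fieldType) (H : falgType k)
    (hopfH : hopf_structure H) (z : nonzero k) : {vspace H} :=
  passmx.leigenspace (antipode hopfH \o antipode hopfH)%VF (nonzero_val z).

Lemma mem_antipode2_eigenspace (k : fieldType) (H : falgType k)
    (hopfH : hopf_structure H) (z : nonzero k) (h : H) :
  (h \in antipode2_eigenspace hopfH z) =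
  (antipode hopfH (antipode hopfH h) == nonzero_val z *: h).
Proof.
rewrite memv_ker add_lfunE opp_lfunE scale_lfunE id_lfunE comp_lfunE.
by rewrite subr_eq0.
Qed.

(* Main.v *)
Require Import Defs.
From mathcomp Require Import all_boot all_algebra falgebra.

(** The counit is a character of H fixed by the antipode, so it is fixed by
    S^2: for h in H_z one gets eps(h) = z eps(h), and eps vanishes on H_z
    whenever z <> 1. In a strong grading the unit of H lies in
    H_1 = H_z H_(z^-1), on which the multiplicative map eps then vanishes too,
    although eps(1) = 1. So a strong grading leaves no room for any z <> 1 in
    the group of nonzero scalars; all of H is then H_1, that is, S^2 = id.
    The argument rests on [counit_antipode] and [counit_eigen0]. *)

Set Implicit Arguments.
Unset Strict Implicit.
Unset Printing Implicit Defensive.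

Import GRing.Theory.
Local Open Scope ring_scope.

Section Antipode.
Variables (k : fieldType) (H : falgType k) (hopfH : hopf_structure H).
Local Notation eps := (counit hopfH).
Local Notation S := (antipode hopfH).
Local Notation Heig := (antipode2_eigenspace hopfH).

(** Apply eps to S(h_(1)) h_(2) = eps(h) 1: the left side becomes
    eps(S(h_(1))) eps(h_(2)) = eps(S(h_(1) eps(h_(2)))), and the counit law
    contracts the argument of S to h. *)
Lemma counit_antipode h : eps (S h) = eps h.
Proof.
have := congr1 eps (antipodel hopfH h).
rewrite linearZ rmorph1 /= mulr1 => <-.
rewrite -{1}(counitr hopfH h) /tens_lift !linear_sum.
apply: eq_bigr => i _; rewrite !linear_sum; apply: eq_bigr => j _.
by rewrite !linearZ rmorphM /= [X in _ * X = _]mulrC.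
Qed.

Lemma antipode1 : S 1 = 1.
Proof.
have := antipodel hopfH 1.
rewrite comul1 tens_lift_tens ?mulr1 ?rmorph1 ?scale1r //.
by split=> [w | v] a x y /=; rewrite ?linearP ?mulrDl ?mulrDr -?scalerAl -?scalerAr.
Qed.

Lemma one_antipode2_eigenspace : 1 \in Heig 1%g.
Proof. by rewrite mem_antipode2_eigenspace !antipode1 scale1r. Qed.

(** Since eps is invariant under S^2, an S^2-eigenvector on which it does not
    vanish has eigenvalue 1. *)
Lemma counit_eigen0 (z : nonzero k) h :
  z != 1%g -> h \in Heig z -> eps h = 0.
Proof.
move=> z1; rewrite mem_antipode2_eigenspace => /eqP/(congr1 eps).
rewrite !counit_antipode linearZ /= => /eqP.
rewrite -subr_eq0 -{1}[eps h]mul1r -mulrBl mulf_eq0 subr_eq0 eq_sym.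
by case/orP=> [|/eqP //]; rewrite -[z == _]/(val z == 1) in z1; rewrite (negPf z1).
Qed.

(** If z <> 1 then eps kills H_z H_(z^-1) = H_1, which contains the unit. *)
Lemma strongly_graded_trivial (z : nonzero k) :
  strongly_graded Heig -> z = 1%g.
Proof.
move=> sgH; apply/eqP; apply: contraT => z1.
have: (Heig z * Heig z^-1%g <= lker (linfun (eps : H -> k^o)))%VS.
  apply/prodvP=> u v uz _.
  have uv0: eps (u * v) = 0 by rewrite rmorphM /= (counit_eigen0 z1 uz) mul0r.
  by rewrite memv_ker lfunE; apply/eqP.
rewrite sgH mulgV => /subvP/(_ 1 one_antipode2_eigenspace).
by rewrite memv_ker lfunE /= rmorph1 oner_eq0.
Qed.

End Antipode.

Theorem corollary2p2 (k : fieldType) (H : falgType k)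
    (hopfH : hopf_structure H)
    (antipode2_neq_id :
      (antipode hopfH \o antipode hopfH)%VF <> (\1)%VF)
    (decompH : direct_sum_decomposition (antipode2_eigenspace hopfH)) :
  ~ strongly_graded (antipode2_eigenspace hopfH).
Proof.
move=> sgH; apply: antipode2_neq_id; apply/lfunP=> h.
have [s hs] := decompH.1 h.
have: h \in antipode2_eigenspace hopfH 1%g.
  apply: subvP hs; elim/big_ind: _ => [|U V sU sV|z _]; first exact: sub0v.
    by rewrite subv_add sU.
  by rewrite (strongly_graded_trivial z sgH).
by rewrite mem_antipode2_eigenspace comp_lfunE id_lfunE scale1r => /eqP.
Qed.
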